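(* Let $G$ be a finite commutative group with $|G|=q$, and let $A_1,A_2\subset G$ be standard sets. Then \[ \delta(A_1\cup A_2)\ge\delta(A_1)\,\delta(A_2). \]
   Context: $G$ is written additively. A set $A\subset G$ is a standard set if $A=-A$ and $0\in A$. For a standard set $A$, $\Delta(A)=\max\{|B|:B\subset G,\ (B-B)\cap A=\{0\}\}$ and $\delta(A)=\Delta(A)/q$. *)

(* Defs.v *)
From mathcomp Require Import all_boot all_order all_algebra.
Set Implicit Arguments.
Unset Strict Implicit.
Unset Printing Implicit Defensive.
Import GRing.Theory.
Local Open Scope ring_scope.

Section StandardSets.
Variable G : finZmodType.
Implicit Types A B : {set G}.

Definition standard_set A : Prop := A = [set - x | x in A] /\ 0 \in A.

Definition diff_set B : {set G} := [set x - y | x in B, y in B].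

(* The family of admissible B contains [set 0] whenever 0 \in A, so for a
   standard set this is a genuine maximum, not the default value 0 of \max. *)
Definition Delta A : nat :=
  \max_(B : {set G} | diff_set B :&: A == [set 0]) #|B|.

Definition delta A : rat := (Delta A)%:R / #|G|%:R.

End StandardSets.

(* Main.v *)
Require Import Defs.
From mathcomp Require Import all_boot all_order all_algebra.
Import Order.TTheory GRing.Theory Num.Theory.
Local Open Scope ring_scope.

(** Let [B1], [B2] be extremal for [A1], [A2].  For every [t], the set
    [B1 :&: (B2 + t)] is admissible for [A1 :|: A2].  As [t] runs over [G], the
    sizes of these intersections add up to [#|B1| * #|B2|], so this product is
    at most [#|G|] times [Delta (A1 :|: A2)]. *)

Section Admissible.
Variable G : finZmodType.
Implicit Types A B : {set G}.

(* Unlike the condition in [Delta], this one also holds for the empty set. *)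
Definition separated A B : Prop :=
  {in B &, forall x y, x - y \in A -> x = y}.

(** Since [0 \in A], the inclusion of [[set 0]] in the intersection says that some [b - b] exists,
    i.e. that [B] is nonempty; the other inclusion is separation. *)
Lemma diff_setI_eq1P A B : 0 \in A ->
  diff_set B :&: A = [set 0] <-> B != set0 /\ separated A B.
Proof.
move=> A0; split=> [dBA | [/set0Pn [b Bb] sepB]].
  split=> [|x y Bx By Axy].
    have: (0 : G) \in diff_set B :&: A by rewrite dBA set11.
    by case/setIP=> /imset2P [x y Bx _ _] _; apply/set0Pn; exists x.
  apply/eqP; rewrite -subr_eq0 -in_set1 -dBA inE Axy andbT.
  by apply/imset2P; exists x y.
apply/setP=> z; rewrite !inE; apply/andP/eqP=> [[] | ->].
  by case/imset2P=> x y Bx By -> /(sepB _ _ Bx By) ->; rewrite subrr.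
by split=> //; apply/imset2P; exists b b; rewrite ?subrr.
Qed.

Lemma leq_Delta A B : 0 \in A -> separated A B -> (#|B| <= Delta A)%N.
Proof.
(* The empty set is separated but not in the family defining [Delta], so it is treated apart. *)
move=> A0 sepB; have [->|B0] := eqVneq B set0; first by rewrite cards0.
by apply: leq_bigmax_cond; apply/eqP/diff_setI_eq1P.
Qed.

Lemma Delta_attained A : 0 \in A ->
  exists2 B, separated A B & #|B| = Delta A.
Proof.
move=> A0.
have adm0 : diff_set [set 0] :&: A == [set 0].
  apply/eqP/diff_setI_eq1P => //; split.
    by apply/set0Pn; exists 0; rewrite set11.
  by move=> x y /set1P -> /set1P ->.
have [|B] := eq_bigmax_cond (fun B : {set G} => #|B|)
  (A := [pred B : {set G} | diff_set B :&: A == [set 0]]).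
  by apply/card_gt0P; exists [set 0].
move=> /eqP /(diff_setI_eq1P _ _ A0) [_ sepB] maxB.
by exists B => //; exact: esym maxB.
Qed.

(** Double counting: each [x] in [B1] is counted once for every [t] with [x - t] in [B2], and there
    are [#|B2|] such [t] because [t |-> x - t] is a bijection. *)
Lemma sum_card_setI_translate (B1 B2 : {set G}) :
  (\sum_t #|B1 :&: [set x | (x - t)%R \in B2]| = #|B1| * #|B2|)%N.
Proof.
under eq_bigr => t _ do rewrite -sum1_card big_mkcond /=.
rewrite exchange_big -sum_nat_const [RHS]big_mkcond /=.
apply: eq_bigr => x _.
under eq_bigr => t _ do rewrite !inE.
case: (x \in B1) => /=; last exact: big1.
rewrite -big_mkcond -sum1_card (reindex_inj (inj_comp (addrI x) oppr_inj)) /=.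
by apply: eq_bigl => t; rewrite opprD opprK addrA subrr add0r.
Qed.

Lemma Delta_setU A1 A2 : 0 \in A1 -> 0 \in A2 ->
  (Delta A1 * Delta A2 <= #|G| * Delta (A1 :|: A2))%N.
Proof.
move=> A10 A20.
have [B1 sep1 <-] := Delta_attained _ A10.
have [B2 sep2 <-] := Delta_attained _ A20.
rewrite -sum_card_setI_translate -sum_nat_const leq_sum // => t _.
apply: leq_Delta; first by rewrite inE A10.
move=> x y; rewrite !inE => /andP [B1x B2x] /andP [B1y B2y] /orP [Axy|Axy].
  exact: sep1.
(* Translation preserves differences: [(x - t) - (y - t) = x - y], so separation of [B2] applies to
   the shifted points. *)
apply: (addIr (- t)); apply: sep2 => //.
by rewrite opprD opprK addrACA addNr addr0.
Qed.

End Admissible.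

Theorem theorem6p2 (G : finZmodType) (A1 A2 : {set G})
    (hA1 : standard_set A1) (hA2 : standard_set A2) :
  delta (A1 :|: A2) >= delta A1 * delta A2.
Proof.
have q_gt0 : (0 < #|G|)%N by apply/card_gt0P; exists 0.
have q_gt0R : 0 < #|G|%:R :> rat by rewrite ltr0n.
(* Multiplying by the square of [#|G|] leaves one factor [#|G|] on the side of the union. *)
rewrite /delta mulf_div ler_pdivrMr ?mulr_gt0 // mulrA divfK ?gt_eqF //.
rewrite -!natrM ler_nat [leqRHS]mulnC.
by apply: Delta_setU; [case: hA1 | case: hA2].
Qed.
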